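(* Let $R$ be a finite non-commutative ring satisfying at least one of the following conditions: (i) $R$ is a $4$-centralizer ring; (ii) $R$ is a $5$-centralizer ring; (iii) $R$ is a $7$-centralizer ring; (iv) $R$ is a $(p+2)$-centralizer ring and $|R|=p^k$ for some prime $p$ and some $k\in\mathbb{N}$; (v) $\Pr(R)=\frac{5}{8}$; (vi) $\Pr(R)=\frac{p^2+p-1}{p^3}$, where $p$ is the smallest prime divisor of $|R|$; (vii) $|R|=p^2$ for some prime $p$; (viii) $R$ has unity and $|R|=p^3$ for some prime $p$. Then $\Gamma_R$ is MSN-integral but not MSN-hyperenergetic.
   Context: Rings are associative and need not have a unity unless stated. For a ring $R$, $Z(R)$ is its center; $R$ is an $n$-centralizer ring if the set of centralizers $\{C_R(r): r\in R\}$, where $C_R(r)=\{s\in R: rs=sr\}$, has exactly $n$ elements. The commuting probability of a finite ring is $\Pr(R)=|\{(x,y)\in R\times R: xy=yx\}|/|R|^2$. For a finite non-commutative ring $R$, the commuting graph $\Gamma_R$ is the simple graph with vertex set $R\setminus Z(R)$ in which two distinct vertices are adjacent if they commute. Let $\Gamma$ be a finite simple graph with vertices $v_1,\dots,v_n$. Let $N(v_i)$ be the set of vertices adjacent to $v_i$, let $N^2(v_i)=\big(\bigcup_{u\in N(v_i)}N(u)\big)\setminus\{v_i\}$, and let $\delta_2(v_i)=\sum_{x\in N^2(v_i)}\deg x$. The minimum second neighborhood degree matrix $\mathrm{snm}(\Gamma)$ is the $n\times n$ matrix whose $(i,j)$ entry is $\min\{\delta_2(v_i),\delta_2(v_j)\}$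 if $i\neq j$ and $v_i,v_j$ are adjacent, and $0$ otherwise. The MSN-energy $E_{\mathrm{sn}}(\Gamma)$ is the sum of the absolute values of the eigenvalues of $\mathrm{snm}(\Gamma)$, counted with multiplicity. $\Gamma$ is MSN-integral if all eigenvalues of $\mathrm{snm}(\Gamma)$ are integers, and MSN-hyperenergetic if $E_{\mathrm{sn}}(\Gamma)>E_{\mathrm{sn}}(K_n)$, where $K_n$ is the complete graph on $n=|V(\Gamma)|$ vertices. *)

(* Defs.v *)
From HB Require Import structures.
From mathcomp Require Import all_boot all_order all_algebra all_field.

Set Implicit Arguments.
Unset Strict Implicit.
Unset Printing Implicit Defensive.

Import Order.TTheory GRing.Theory Num.Theory.
Local Open Scope ring_scope.

(* Finite associative rings in which a unity is not required; the ring        *)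
(* structures of MathComp all contain a unity.                                *)
Record finRng := FinRng {
  rng_sort :> finZmodType;
  rng_mul : rng_sort -> rng_sort -> rng_sort;
  rng_mulA : associative rng_mul;
  rng_mulDl : left_distributive rng_mul +%R;
  rng_mulDr : right_distributive rng_mul +%R
}.

Definition rng_comm (R : finRng) (x y : R) : bool := rng_mul x y == rng_mul y x.

Definition rng_noncommutative (R : finRng) : Prop :=
  exists x y : R, rng_mul x y <> rng_mul y x.

Definition rng_has_unity (R : finRng) : Prop :=
  exists e : R, forall x : R, rng_mul e x = x /\ rng_mul x e = x.

Definition rng_center (R : finRng) : {set R} :=
  [set z : R | [forall x : R, rng_comm z x]].

Definition rng_centralizer (R : finRng) (r : R) : {set R} :=
  [set s : R | rng_comm r s].

Definition n_centralizer_ring (n : nat) (R : finRng) : Prop :=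
  #|[set rng_centralizer r | r in [set: R]]| = n.

Definition commuting_probability (R : finRng) : rat :=
  #|[set xy : R * R | rng_comm xy.1 xy.2]|%:R / #|R|%:R ^+ 2.

Record sgraph := SGraph {
  vertex :> finType;
  adj : rel vertex;
  adj_sym : symmetric adj;
  adj_irr : irreflexive adj
}.

Definition nbhd (G : sgraph) (v : G) : {set G} := [set u | adj v u].

Definition deg (G : sgraph) (v : G) : nat := #|nbhd v|.

Definition nbhd2 (G : sgraph) (v : G) : {set G} :=
  (\bigcup_(u in nbhd v) nbhd u) :\ v.

Definition delta2 (G : sgraph) (v : G) : nat :=
  (\sum_(x in nbhd2 v) deg x)%N.

(* The vertices are listed as v_i = enum_val i. The entries are natural       *)
(* numbers, seen in algC so that the characteristic polynomial splits.        *)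
Definition snm (G : sgraph) : 'M[algC]_#|G| :=
  \matrix_(i, j)
    let vi : G := enum_val i in let vj : G := enum_val j in
    if (i != j) && adj vi vj then (minn (delta2 vi) (delta2 vj))%:R else 0.

(* The eigenvalues of M, listed with multiplicity.                            *)
Definition spectrum (n : nat) (M : 'M[algC]_n) : seq algC :=
  sval (closed_field_poly_normal (char_poly M)).

Lemma spectrumP (n : nat) (M : 'M[algC]_n) :
  char_poly M = \prod_(z <- spectrum M) ('X - z%:P).
Proof.
rewrite /spectrum; case: closed_field_poly_normal => s /= {1}->.
by rewrite (monicP (char_poly_monic M)) scale1r.
Qed.

Definition msn_energy (G : sgraph) : algC := \sum_(z <- spectrum (snm G)) `|z|.

Definition msn_integral (G : sgraph) : Prop :=
  forall a : algC, eigenvalue (snm G) a -> a \is a Num.int.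

Definition complete_adj (n : nat) : rel 'I_n := fun i j => i != j.

Lemma complete_adj_sym (n : nat) : symmetric (@complete_adj n).
Proof. by move=> i j; rewrite /complete_adj eq_sym. Qed.

Lemma complete_adj_irr (n : nat) : irreflexive (@complete_adj n).
Proof. by move=> i; rewrite /complete_adj eqxx. Qed.

Definition complete_graph (n : nat) : sgraph :=
  SGraph (@complete_adj_sym n) (@complete_adj_irr n).

Definition msn_hyperenergetic (G : sgraph) : Prop :=
  msn_energy (complete_graph #|G|) < msn_energy G.

Definition commuting_adj (R : finRng) : rel {x : R | x \notin rng_center R} :=
  fun u v => (u != v) && rng_comm (val u) (val v).

Lemma commuting_adj_sym (R : finRng) : symmetric (@commuting_adj R).
Proof.
by move=> u v; rewrite /commuting_adj /rng_comm eq_sym [X in _ && X]eq_sym.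
Qed.

Lemma commuting_adj_irr (R : finRng) : irreflexive (@commuting_adj R).
Proof. by move=> u; rewrite /commuting_adj eqxx. Qed.

Definition commuting_graph (R : finRng) : sgraph :=
  SGraph (@commuting_adj_sym R) (@commuting_adj_irr R).

(* Main.v *)
Require Import Defs.
From mathcomp Require Import all_boot all_order all_fingroup all_solvable.
From mathcomp Require Import all_algebra all_field.
From mathcomp Require Import ring zify.
Set Implicit Arguments.
Unset Strict Implicit.
Unset Printing Implicit Defensive.

Import Order.TTheory GRing.Theory Num.Theory.
Local Open Scope ring_scope.

(* Each condition forces commutation to be transitive on noncentral elements, *)
(* so that [commuting_graph R] is a disjoint union of cliques. In such a      *)
(* graph [delta2] is constant on each clique, and on a clique of degree [d]   *)
(* the eigenvalues of [snm] are [- delta2] and [delta2 * d]. With [n]         *)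
(* vertices, all eigenvalues are thus at least [- (n - 1)^2]; as their sum is *)
(* the trace 0, the energy is at most [2 (n - 1)^3], while [K_n] has the      *)
(* eigenvalue [(n - 1)^3], hence an energy of at least [2 (n - 1)^3].         *)
(* Transitivity of commutation follows from counting the centralizers of      *)
(* explicit elements when there are few of them, and from Lagrange's theorem  *)
(* when the center has small index; the commuting probability bounds that     *)
(* index.                                                                     *)

(** Everything passes through [comm_transitive]. Under it [commuting_graph R] is a [cluster], and
    [cluster_eigenvalue] gives integrality. The bounds [cluster_energy_le] and [energy_complete_ge]
    meet at the same number 2 (n - 1)^3, which excludes hyperenergetic clusters on n > 2 vertices.
    Three lemmas supply transitivity: [comm_transitive_card_centralizers] for 4, 5 or 7
    centralizers, [comm_transitive_prime_power] for p + 2 of them, and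
    [comm_transitive_center_index] for the conditions on the order and, through
    [commuting_probability_center], for those on the probability. *)

Lemma size_spectrum (n : nat) (M : 'M[algC]_n) : size (spectrum M) = n.
Proof.
have := size_char_poly M; rewrite spectrumP size_prod_XsubC.
by move=> [].
Qed.

Lemma mem_spectrum (n : nat) (M : 'M[algC]_n) (a : algC) :
  (a \in spectrum M) = eigenvalue M a.
Proof. by rewrite eigenvalue_root_char spectrumP root_prod_XsubC. Qed.

Lemma sum_spectrum (n : nat) (M : 'M[algC]_n) :
  \sum_(z <- spectrum M) z = \tr M.
Proof.
case: n M => [|n] M.
  by rewrite (size0nil (size_spectrum M)) big_nil /mxtrace big_ord0.
apply: oppr_inj; rewrite -char_poly_trace // spectrumP.
by rewrite -coefPn_prod_XsubC ?size_spectrum.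
Qed.

(** As the sum is 0, each [|z|] may be replaced by [|z| - z], which is 0 for nonnegative [z] and at
    most [2 D] otherwise. Some entry is nonnegative, which saves one term. *)
Lemma sum_norm_sum0_le (s : seq algC) (D : algC) :
    {in s, forall z, - D <= z} -> 0 <= D -> \sum_(z <- s) z = 0 ->
  \sum_(z <- s) `|z| <= (size s).-1%:R * (2%:R * D).
Proof.
move=> sD D0 s0.
have rs z : z \in s -> z \is Num.real.
  by move=> /sD zD; rewrite -(ler_real zD) rpredN ger0_real.
case: (boolP (has (fun z => 0 <= z) s)) => [/hasP[z0 z0s z00]|].
  have -> : \sum_(z <- s) `|z| = \sum_(z <- s) (`|z| - z).
    by rewrite big_split /= sumrN s0 subr0.
  rewrite (big_rem z0) //= ger0_norm // subrr add0r -(size_rem z0s).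
  rewrite -sum1_size natr_sum mulr_suml big_seq [leRHS]big_seq.
  apply: ler_sum => z /mem_rem zs; rewrite mul1r.
  have := sD _ zs; have := rs _ zs.
  rewrite realE => /orP[z_ge0|z_le0] zD.
    rewrite ger0_norm // subrr.
    by rewrite mulr_ge0 ?ler0n.
  rewrite ler0_norm // -mulr2n -[_ *+ 2]mulr_natl.
  by rewrite ler_pM2l ?ltr0n // lerNl.
move=> /hasPn nneg.
have neg z : z \in s -> z < 0.
  by move=> zs; have := nneg _ zs; rewrite real_leNgt ?real0 ?rs // negbK.
case: s s0 neg {sD rs nneg} => [|z s]; first by rewrite !big_nil mul0r.
rewrite big_cons => s0 neg.
have : z + \sum_(j <- s) j < 0.
  rewrite ltr_wnDr ?neg ?mem_head // big_seq sumr_le0 // => i si.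
  by rewrite ltW // neg // inE si orbT.
by rewrite s0 ltxx.
Qed.

Lemma sum_norm_sum0_ge (s : seq algC) (a : algC) :
  a \in s -> \sum_(z <- s) z = 0 -> 2%:R * `|a| <= \sum_(z <- s) `|z|.
Proof.
move=> sa; rewrite !(big_rem a sa) /= => /eqP; rewrite addr_eq0 => /eqP s0.
by rewrite mulr_natl mulr2n lerD2l [in leLHS]s0 normrN ler_norm_sum.
Qed.

Lemma trace_snm (G : sgraph) : \tr (snm G) = 0.
Proof. by rewrite /mxtrace big1 // => i _; rewrite mxE eqxx. Qed.

Lemma card_adj_enum_val (G : sgraph) (v : G) :
  #|[pred i : 'I_#|G| | adj (enum_val i) v]| = deg v.
Proof.
rewrite /deg -(on_card_preimset (f := @enum_val G G)).
  by apply: eq_card => i; rewrite !inE adj_sym.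
exact/onW_bij/enum_val_bij.
Qed.

(** * Disjoint unions of cliques *)

Definition cluster (G : sgraph) : Prop :=
  forall u v w : G, adj u v -> adj v w -> u != w -> adj u w.

Lemma deg_lt (G : sgraph) (v : G) : (deg v < #|G|)%N.
Proof.
rewrite /deg -cardsT; apply: proper_card; apply/properP; split => //.
by exists v; rewrite // inE adj_irr.
Qed.

Section Cluster.
Variables (G : sgraph) (clG : cluster G).

Lemma cluster_deg (u v : G) : adj u v -> deg u = deg v.
Proof.
move=> uv; have: #|u |: nbhd u| = #|v |: nbhd v|.
  apply: eq_card => w; rewrite !inE.
  case: (eqVneq w u) => [->|wu]; first by rewrite adj_sym uv orbT.
  case: (eqVneq w v) => [->|wv] //=.
  apply/idP/idP => h; apply: clG; [|exact: h| |exact: uv|exact: h|];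
    by rewrite 1?eq_sym // adj_sym.
by rewrite !cardsU1 !inE !adj_irr => -[].
Qed.

(** In a clique with at least three vertices every neighbor of [v] is also reached in two steps. In
    a clique of two, the only walk of length two returns to [v], which [nbhd2] removes. *)
Lemma cluster_delta2 (v : G) :
  delta2 v = if (1 < deg v)%N then (deg v ^ 2)%N else 0%N.
Proof.
have sub x : x \in nbhd2 v -> adj v x.
  rewrite !inE => /andP[xv /bigcupP[u]]; rewrite !inE => vu ux.
  by apply: clG ux _; rewrite // eq_sym.
rewrite /delta2.
have -> : \sum_(x in nbhd2 v) deg x = (#|nbhd2 v| * deg v)%N.
  rewrite -sum_nat_const; apply: eq_bigr => x /sub vx.
  by apply: cluster_deg; rewrite adj_sym.
case: ifP => [d1|/negbT]; last first.
  rewrite -leqNgt => d1; apply/eqP; rewrite muln_eq0 cards_eq0; apply/orP; left.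
  apply/eqP/setP => x; rewrite in_set0; apply/negP => xv.
  have vx := sub _ xv; move: xv; rewrite !inE => /andP[_ /bigcupP[u]].
  rewrite !inE => vu ux; move/card_le1_eqP: d1 => /(_ u x).
  by rewrite !inE => /(_ vu vx) E; rewrite E adj_irr in ux.
rewrite -mulnn; congr muln; apply: eq_card => x; rewrite [RHS]inE.
apply/idP/idP => [/sub//|vx]; rewrite !inE.
have /card_gt1P[a [b [va vb ab]]] := d1.
have [u vu ux] : exists2 u, adj v u & u != x.
  rewrite !inE in va vb.
  case: (eqVneq a x) ab => [-> xb|ax _]; last by exists a.
  by exists b => //; rewrite eq_sym.
apply/andP; split; first by apply: contraTneq vx => ->; rewrite adj_irr.
apply/bigcupP; exists u; rewrite inE //.
by apply: clG vx ux; rewrite adj_sym.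
Qed.

Lemma cluster_snmE (i j : 'I_#|G|) :
  snm G i j =
    if adj (enum_val i) (enum_val j) then (delta2 (enum_val j))%:R else 0.
Proof.
rewrite mxE; case: (eqVneq i j) => [->|_]; first by rewrite adj_irr.
rewrite /=; case: ifP => // ij.
by rewrite !cluster_delta2 (cluster_deg ij) minnn.
Qed.

Lemma cluster_delta2_le (v : G) : (delta2 v <= #|G|.-1 ^ 2)%N.
Proof.
rewrite cluster_delta2; case: ifP => // _.
by rewrite leq_exp2r // -ltnS prednK ?deg_lt // (leq_trans _ (deg_lt v)).
Qed.

(* On the clique of a coordinate where the eigenvector does not vanish,       *)
(* [(a + delta) v_j = delta * S], where [S] is the sum of [v] on the clique. *)
Lemma cluster_eigenvalue (a : algC) : eigenvalue (snm G) a ->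
  exists v : G, a = - (delta2 v)%:R \/ a = (delta2 v * deg v)%:R.
Proof.
case/eigenvalueP => v va /rV0Pn[j vj]; exists (enum_val j).
set d := (delta2 _)%:R.
pose C := [pred i | (i == j) || adj (enum_val i) (enum_val j)].
pose S := \sum_(i in C) v 0 i.
have eq_i i : i \in C -> (a + d) * v 0 i = d * S.
  move=> Ci; have := congr1 (fun w : 'rV_#|G| => w 0 i) va; rewrite !mxE => E.
  have di : delta2 (enum_val i) = delta2 (enum_val j).
    move: Ci; rewrite inE => /orP[/eqP->//|ij].
    by rewrite !cluster_delta2 (cluster_deg ij).
  rewrite mulrDl -E /S (bigD1 i Ci) /= mulrDr addrC; congr (_ + _).
  rewrite (bigID [pred k | adj (enum_val k) (enum_val i)]) /=.
  rewrite [X in _ + X]big1 ?addr0 => [|k /negPf ki]; last first.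
    by rewrite cluster_snmE ki mulr0.
  rewrite mulr_sumr; apply: eq_big => [k|k ki]; last first.
    by rewrite cluster_snmE ki di mulrC.
  move: Ci; rewrite !inE => /orP[/eqP->|ij].
    by case: eqVneq => [->|] //=; rewrite ?adj_irr ?andbT.
  case: (eqVneq k i) => [->|ki]; first by rewrite adj_irr andbF.
  rewrite andbT; case: (eqVneq k j) => [->|kj] /=; first by rewrite adj_sym.
  apply/idP/idP => h; apply: clG;
    [exact: h|exact: ij| |exact: h|by rewrite adj_sym|];
    by rewrite (inj_eq enum_val_inj).
have cardC : #|C| = (deg (enum_val j)).+1.
  rewrite (cardD1 j) !inE eqxx -card_adj_enum_val; congr _.+1.
  apply: eq_card => i; rewrite !inE.
  by case: eqVneq => [->|] //=; rewrite adj_irr.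
(* Sum [eq_i] over the clique, which has [deg + 1] members. *)
have : S * (a - d * (deg (enum_val j))%:R) = 0.
  have : \sum_(i in C) (a + d) * v 0 i = \sum_(i in C) d * S by apply: eq_bigr.
  rewrite -mulr_sumr -/S sumr_const cardC mulrSr -[d * S *+ _]mulr_natr => E.
  rewrite mulrBr; have -> : S * a = d * S * (deg (enum_val j))%:R.
    by apply: (addIr (d * S)); rewrite -E; ring.
  by ring.
move/eqP; rewrite mulf_eq0 => /orP[/eqP S0|]; last first.
  by rewrite subr_eq0 -natrM => /eqP->; right.
have := eq_i j; rewrite inE eqxx S0 mulr0 => /(_ isT)/eqP.
by rewrite mulf_eq0 (negPf vj) orbF addr_eq0 => /eqP->; left.
Qed.

Lemma cluster_msn_integral : msn_integral G.
Proof. by move=> a /cluster_eigenvalue[v [->|->]]; rewrite ?rpredN rpred_nat. Qed.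

Lemma cluster_energy_le : msn_energy G <= (2 * #|G|.-1 ^ 3)%:R.
Proof.
apply: le_trans (sum_norm_sum0_le (D := (#|G|.-1 ^ 2)%:R) _ _ _) _ => //.
- move=> z; rewrite mem_spectrum => /cluster_eigenvalue[v [->|->]].
    by rewrite lerN2 ler_nat cluster_delta2_le.
  by rewrite (@le_trans _ _ 0) // oppr_le0.
- by rewrite sum_spectrum trace_snm.
by rewrite size_spectrum -!natrM ler_nat; nia.
Qed.

End Cluster.

(** * Comparison with the complete graph *)

(** The all-ones vector has eigenvalue (n - 1)^3. The bound fails for n = 2, where [delta2] vanishes
    and the energy is 0. *)
Lemma energy_complete_ge (n : nat) :
  (2 < n)%N -> (2 * n.-1 ^ 3)%:R <= msn_energy (complete_graph n).
Proof.
move=> n2; set K := complete_graph n.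
have clK : cluster K by [].
have cK : #|K| = n by rewrite card_ord.
have degK (v : K) : deg v = n.-1.
  rewrite /deg -[in RHS]cK -cardsT [in RHS](cardsD1 v) in_setT.
  by apply: eq_card => u; rewrite !inE andbT adj_sym.
have dK (v : K) : delta2 v = (n.-1 ^ 2)%N.
  by rewrite cluster_delta2 // degK; case: ifP => //; lia.
have ev : eigenvalue (snm K) (n.-1 ^ 3)%:R.
  apply/eigenvalueP; exists (const_mx 1); last first.
    have i : 'I_#|K| by rewrite cK; exact: Ordinal (ltnW n2).
    by apply/rV0Pn; exists i; rewrite mxE oner_eq0.
  apply/rowP => j; rewrite !mxE mulr1.
  under eq_bigr => i _ do rewrite mxE mul1r cluster_snmE // dK.
  by rewrite -big_mkcond sumr_const card_adj_enum_val degK -mulrnA -expnSr.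
rewrite natrM -[X in _ * X]ger0_norm //.
by apply: sum_norm_sum0_ge; rewrite ?mem_spectrum // sum_spectrum trace_snm.
Qed.

Lemma cluster_not_msn_hyperenergetic (G : sgraph) :
  cluster G -> (2 < #|G|)%N -> ~ msn_hyperenergetic G.
Proof.
move=> clG G2; rewrite /msn_hyperenergetic => hyp.
have := le_trans (cluster_energy_le clG) (energy_complete_ge G2).
by move/(lt_le_trans hyp); rewrite ltxx.
Qed.

(** * Commutation and the additive group of [R] *)

Section Ring.
Variable R : finRng.
Implicit Types x y z t u w : R.

Local Notation "x ** y" := (rng_comm x y) (at level 55).
Local Notation C := (@rng_centralizer R).
Local Notation Z := (rng_center R).

Lemma rng_comm_sym x y : x ** y = y ** x.
Proof. exact: eq_sym. Qed.

Lemma rng_comm_refl x : x ** x.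
Proof. exact: eqxx. Qed.

Lemma rng_mul0r x : rng_mul 0 x = 0.
Proof. by apply: (addIr (rng_mul 0 x)); rewrite -rng_mulDl !add0r. Qed.

Lemma rng_mulr0 x : rng_mul x 0 = 0.
Proof. by apply: (addIr (rng_mul x 0)); rewrite -rng_mulDr !add0r. Qed.

Lemma rng_comm0 x : x ** 0.
Proof. by rewrite /rng_comm rng_mul0r rng_mulr0. Qed.

Lemma rng_commDr x y z : x ** y -> x ** (y + z) = x ** z.
Proof.
by rewrite /rng_comm rng_mulDl rng_mulDr => /eqP->; rewrite (inj_eq (addrI _)).
Qed.

Lemma rng_commDl x y z : x ** z -> x ** (y + z) = x ** y.
Proof. by rewrite addrC; apply: rng_commDr. Qed.

Lemma rng_commN x y : x ** (- y) = x ** y.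
Proof.
apply/idP/idP => h; first by rewrite -(rng_commDr y h) addNr rng_comm0.
by rewrite -(rng_commDr (- y) h) addrN rng_comm0.
Qed.

Lemma rng_commMn x y n : x ** y -> x ** (y *+ n).
Proof.
move=> xy; elim: n => [|n IH]; first by rewrite mulr0n rng_comm0.
by rewrite mulrS rng_commDr.
Qed.

(** Since [#|R|] annihilates [R], Bezout makes [y] a multiple of [y *+ n]. *)
Lemma rng_commMn_coprime x y n :
  coprime n #|R| -> x ** (y *+ n) = x ** y.
Proof.
move=> co; apply/idP/idP => [h|]; last exact: rng_commMn.
have yR : y *+ #|R| = 0.
  by rewrite -FinRing.zmodXgE -cardsT expg_cardG ?inE // FinRing.zmod1gE.
(* [n = 0] is coprime to [#|R|] only if [R] is trivial, and then [y = 0]. *)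
case: n co h => [|n] co h.
  move: co yR; rewrite /coprime gcd0n => /eqP->; rewrite mulr1n => ->.
  exact: rng_comm0.
have [u v uv _] := egcdnP #|R| (ltn0Sn n).
have := rng_commMn u h; rewrite -mulrnA mulnC uv (eqP co) mulrnDr mulnC.
by rewrite mulrnA yR mul0rn add0r.
Qed.

Lemma rng_centerP z : reflect (forall x, z ** x) (z \in Z).
Proof. by rewrite inE; apply: forallP. Qed.

Lemma rng_centerPn z : reflect (exists x, ~~ (z ** x)) (z \notin Z).
Proof. by rewrite inE negb_forall; apply: existsP. Qed.

Lemma rng_centralizer_group_set x : group_set (C x).
Proof.
apply/group_setP; split => [|y z]; rewrite !inE; first exact: rng_comm0.
by move=> xy xz; rewrite FinRing.zmodMgE rng_commDr.
Qed.
Canonical rng_centralizer_group x := Group (rng_centralizer_group_set x).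

Lemma rng_center_group_set : group_set Z.
Proof.
apply/group_setP; split => [|y z].
  by apply/rng_centerP => x; rewrite rng_comm_sym rng_comm0.
move=> /rng_centerP yx /rng_centerP zx; apply/rng_centerP => x.
by rewrite FinRing.zmodMgE rng_comm_sym rng_commDr rng_comm_sym.
Qed.
Canonical rng_center_group := Group rng_center_group_set.

(** Equivalently, noncentral elements have commutative centralizers. *)
Definition comm_transitive : Prop :=
  forall x y z, y \notin Z -> x ** y -> y ** z -> x ** z.

Lemma cluster_commuting_graph : comm_transitive -> cluster (commuting_graph R).
Proof.
move=> tr u v w /andP[_ uv] /andP[_ vw] uw; apply/andP; split => //.
exact: tr (valP v) uv vw.
Qed.

Lemma card_commuting_graph : rng_noncommutative R -> (2 < #|commuting_graph R|)%N.
Proof.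
move=> [x [y /eqP nxy]].
have {}nxy : ~~ (x ** y) by [].
have nyx : ~~ (y ** x) by rewrite rng_comm_sym.
have xZ : x \notin Z by apply/rng_centerPn; exists y.
have yZ : y \notin Z by apply/rng_centerPn; exists x.
have xyZ : x + y \notin Z.
  by apply/rng_centerPn; exists x; rewrite rng_comm_sym rng_commDr // rng_comm_refl.
have us : uniq [:: x; y; x + y].
  rewrite /= !inE negb_or andbT -!andbA; apply/and3P; split.
  - by apply: contraNneq nxy => ->; apply: rng_comm_refl.
  - apply: contraNneq nxy => xE; rewrite -(rng_commDr y (rng_comm_refl x)) -xE.
    exact: rng_comm_refl.
  - apply: contraNneq nyx => yE; rewrite -(rng_commDl x (rng_comm_refl y)) -yE.
    exact: rng_comm_refl.
rewrite card_sig -[3%N](card_uniqP us); apply/subset_leq_card/subsetP => t.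
by rewrite !inE => /or3P[] /eqP->; [move: xZ | move: yZ | move: xyZ]; rewrite inE.
Qed.

(** * Transitivity of commutation from centralizers *)

Lemma card_centralizers_ge (s : seq R) :
  uniq (map C s) -> (size s <= #|[set C r | r in [set: R]]|)%N.
Proof.
move=> us; rewrite -(size_map C) -(card_uniqP us); apply/subset_leq_card/subsetP.
by move=> A /mapP[r _ ->]; apply: imset_f; rewrite inE.
Qed.

Lemma eq_centralizer x y t : C x = C y -> (x ** t) = (y ** t).
Proof. by move/setP/(_ t); rewrite !inE. Qed.

Lemma neq_centralizer x y t : (x ** t) != (y ** t) -> C x != C y.
Proof. by apply: contraNneq => /eq_centralizer ->. Qed.

Lemma centralizer_notin_map x (s : seq R) :
  (forall y, y \in s -> exists t, (x ** t) != (y ** t)) -> C x \notin map C s.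
Proof.
move=> h; apply/mapP => -[y /h[t]] /negP xy Cxy; apply: xy.
by rewrite (eq_centralizer t Cxy).
Qed.

(** If a noncentral [y] commuted with noncommuting [x] and [z], then [0], [y], [x] and the [p]
    elements [z + x *+ i] would have p + 3 distinct centralizers. *)
Lemma comm_transitive_prime_power (p k : nat) :
  prime p -> n_centralizer_ring (p + 2) R -> #|R| = (p ^ k)%N ->
  comm_transitive.
Proof.
move=> pp nR cR x y z yZ xy yz; apply/negPn/negP => nxz.
have [w yw] := rng_centerPn _ yZ.
pose f i := z + x *+ i.
pose s := [:: 0, y, x & map f (iota 0 p)].
suff us : uniq (map C s).
  by have := card_centralizers_ge us; rewrite nR /= size_map size_iota addn2 ltnn.
have c0 t : 0 ** t by rewrite rng_comm_sym rng_comm0.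
have fx i : (f i ** x) = false.
  by rewrite rng_comm_sym rng_commDl ?(negPf nxz) // rng_commMn // rng_comm_refl.
rewrite /s !map_cons !cons_uniq -!map_cons; apply/and4P; split.
- apply: centralizer_notin_map => t; rewrite !inE => /or3P[/eqP->|/eqP->|/mapP[i _ ->]].
  + by exists w; rewrite c0 (negPf yw).
  + by exists z; rewrite c0 (negPf nxz).
  + by exists x; rewrite c0 fx.
- apply: centralizer_notin_map => t; rewrite !inE => /orP[/eqP->|/mapP[i _ ->]].
  + by exists z; rewrite yz (negPf nxz).
  + by exists x; rewrite rng_comm_sym xy fx.
- apply: centralizer_notin_map => t /mapP[i _ ->].
  by exists x; rewrite rng_comm_refl fx.
(* Equal centralizers would make [f i] commute with [f j], hence with [x *+ (j - i)], hence with
   [x], as [j - i] is prime to [p]. *)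
have fij i j : (i < j)%N -> (j < p)%N -> C (f i) != C (f j).
  move=> ij jp; apply/negP => /eqP/(eq_centralizer (f j)).
  rewrite rng_comm_refl /f -(subnKC (ltnW ij)) mulrnDr addrA.
  rewrite rng_commDr ?rng_comm_refl //.
  rewrite rng_commMn_coprime ?fx // cR coprimeXr // coprime_sym prime_coprime //.
  by rewrite gtnNdvd ?subn_gt0 // (leq_ltn_trans (leq_subr _ _)).
rewrite -map_comp map_inj_in_uniq ?iota_uniq // => i j.
rewrite !mem_iota /= !add0n => ip jp /eqP.
case: (ltngtP i j) => // [ij|ji]; first by rewrite (negPf (fij _ _ ij jp)).
by rewrite eq_sym (negPf (fij _ _ ji ip)).
Qed.

(* If [y] were noncentral and commuted with noncommuting [x] and [z], then    *)
(* for any [w] outside [C y] the elements [0, y, x, z, x + z, w, w + y] would *)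
(* have all the centralizers; hence any element outside [C y] would have the  *)
(* centralizer of [w] or of [w + y]. The elements commuting with both would   *)
(* then be central, while [x] or [x - y] is one of them.                      *)
Lemma comm_transitive_card_centralizers :
  (#|[set C r | r in [set: R]]| <= 7)%N -> comm_transitive.
Proof.
move=> nR x y z yZ xy yz; apply/negPn/negP => /negPf nxz.
have [w /negPf yw] := rng_centerPn _ yZ.
have yx : y ** x by rewrite rng_comm_sym.
have wy : (w ** y) = false by rewrite rng_comm_sym.
have c0 t : 0 ** t by rewrite rng_comm_sym rng_comm0.
have zx : (z ** x) = false by rewrite rng_comm_sym.
have zy : z ** y by rewrite rng_comm_sym.
have xzx : (x + z ** x) = false by rewrite rng_comm_sym rng_commDr // rng_comm_refl.
have xzz : (x + z ** z) = false by rewrite rng_comm_sym rng_commDl // rng_comm_refl.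
have xzy : x + z ** y by rewrite rng_comm_sym rng_commDl.
have wyw : (w + y ** w) = false by rewrite rng_comm_sym rng_commDr // rng_comm_refl.
have wyy : (w + y ** y) = false by rewrite rng_comm_sym rng_commDl // rng_comm_refl.
have wwy : (w ** w + y) = false by rewrite rng_comm_sym.
pose s := [:: 0; y; x; z; x + z; w; w + y].
have us : uniq (map C s).
  pose facts := (c0, xy, yz, nxz, yw, yx, wy, zx, zy, xzx, xzz, xzy,
    wyw, wyy, rng_comm_refl).
  rewrite /= !inE !negb_or -!andbA.
  by do ?[apply/andP; split] => //;
    first [ apply: (@neq_centralizer _ _ y); rewrite !facts; done
          | apply: (@neq_centralizer _ _ x); rewrite !facts; done
          | apply: (@neq_centralizer _ _ z); rewrite !facts; done
          | apply: (@neq_centralizer _ _ w); rewrite !facts; done ].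
have all u : C u \in map C s.
  have [||_ sF] := uniq_min_size us (s2 := enum [set C r | r in [set: R]]).
  - by move=> A /mapP[r _ ->]; rewrite mem_enum imset_f ?inE.
  - by rewrite -cardE.
  - by rewrite sF mem_enum imset_f ?inE.
have out u : (u ** y) = false -> C u = C w \/ C u = C (w + y).
  move=> uy; have := all u; rewrite !inE => /or4P[|||/or4P[]] /eqP Cu;
    by [left | right |
      move: uy; rewrite (eq_centralizer y Cu) ?c0 ?rng_comm_refl ?xy ?zy ?xzy].
have outD u t : (u ** y) = false -> t ** y -> (u + t ** y) = false.
  by move=> uy ty; rewrite rng_comm_sym rng_commDl rng_comm_sym.
have mid u : w ** u -> w + y ** u -> u \in Z.
  move=> wu wyu; apply/rng_centerP => t; rewrite rng_comm_sym.
  have outu v : (v ** y) = false -> v ** u.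
    by case/out => /(eq_centralizer u) ->.
  (* If [t] commutes with [y], then [w + t] does not, so [u] commutes with both [w + t] and [w]. *)
  case ty: (t ** y); last exact: outu.
  have := outu _ (outD _ _ wy ty).
  by rewrite rng_comm_sym rng_commDr 1?rng_comm_sym // rng_comm_sym.
(* Each of [w + x], [w + y + x] and [w + y + y] lies outside [C y] and commutes with itself, so by
   [out] it commutes with [w] or with [w + y]. *)
have wwx : (w + x ** y) = false by exact: outD.
have wyx : (w + y + x ** y) = false by exact: outD.
case wx: (w ** x).
  case w'x: (w + y ** x).
    by have /rng_centerP/(_ z) := mid _ wx w'x; rewrite nxz.
  case: (out _ wyx) => /(eq_centralizer (w + y + x)); rewrite rng_comm_refl => /esym.
    by rewrite rng_commDl // wwy.
  by rewrite (rng_commDr _ (rng_comm_refl (w + y))) w'x.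
have w'wx : w + y ** w + x.
  case: (out _ wwx) => /(eq_centralizer (w + x)); rewrite rng_comm_refl => /esym //.
  by rewrite rng_commDr ?rng_comm_refl // wx.
case w'x: (w + y ** x); first by move: w'wx; rewrite rng_commDl // wyw.
have wxy : w ** y + x.
  case: (out _ wyx) => /(eq_centralizer (w + y + x)); rewrite rng_comm_refl => /esym.
    by rewrite -addrA (rng_commDr _ (rng_comm_refl w)).
  by rewrite (rng_commDr _ (rng_comm_refl (w + y))) w'x.
have wyy2 : w ** y + y.
  have /out[] : (w + y + y ** y) = false by apply: outD => //; apply: rng_comm_refl.
    move/(eq_centralizer (w + y + y)); rewrite rng_comm_refl => /esym.
    by rewrite -addrA (rng_commDr _ (rng_comm_refl w)).
  move/(eq_centralizer (w + y + y)); rewrite rng_comm_refl => /esym.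
  by rewrite (rng_commDr _ (rng_comm_refl (w + y))) wyy.
have /rng_centerP/(_ z) : x - y \in Z.
  apply: mid.
    have -> : x - y = (y + x) - (y + y) by rewrite opprD addrACA subrr add0r.
    by rewrite rng_commDr ?rng_commN.
  have -> : x - y = (w + x) - (w + y) by rewrite opprD addrACA subrr add0r.
  by rewrite rng_commDr // rng_commN rng_comm_refl.
by rewrite rng_comm_sym rng_commDl ?rng_commN // zx.
Qed.

(* Otherwise [Z < C x :&: C y < C y < R] would be a strict chain of subgroups. *)
Lemma comm_transitive_center_index (p : nat) :
    (forall d, (1 < d)%N -> (d %| #|R|)%N -> (p <= d)%N) ->
  (#|R| < p ^ 3 * #|Z|)%N -> comm_transitive.
Proof.
move=> pmin ltR x y z yZ xy yz; apply/negPn/negP => nxz.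
have [w yw] := rng_centerPn _ yZ.
have step (H K : {group R}) : H \proper K -> (p * #|H| <= #|K|)%N.
  move=> HK; rewrite -(Lagrange (proper_sub HK)) mulnC leq_mul2l pmin ?orbT //.
    by rewrite indexg_gt1 proper_subn.
  by rewrite -cardsT (dvdn_trans (dvdn_indexg K H)) // cardSg ?subsetT.
have sZ t : Z \subset C t.
  by apply/subsetP => u /rng_centerP/(_ t); rewrite inE rng_comm_sym.
have h1 : (p * #|Z| <= #|C x :&: C y|)%N.
  apply: step; apply/properP; split; first by rewrite subsetI !sZ.
  by exists y; rewrite // !inE xy rng_comm_refl.
have h2 : (p * #|C x :&: C y| <= #|C y|)%N.
  apply: (step (C x :&: C y)%G (rng_centralizer_group y)).
  apply/properP; split; first exact: subsetIr.
  by exists z; rewrite !inE // (negPf nxz).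
have h3 : (p * #|C y| <= #|R|)%N.
  rewrite -cardsT; apply: (step (rng_centralizer_group y) [set: R]%G).
  apply/properP; split; first exact: subsetT.
  by exists w; rewrite ?inE.
move: ltR; rewrite ltnNge => /negP; apply; apply: leq_trans h3.
rewrite (expnS p 2) -mulnn -!mulnA leq_mul2l; apply/orP; right.
by apply: leq_trans h2; rewrite leq_mul2l h1 orbT.
Qed.

(** * Commuting probability and the center *)

Lemma card_commuting_pairs :
  #|[set xy : R * R | xy.1 ** xy.2]| = (\sum_x #|C x|)%N.
Proof.
rewrite -sum1_card.
under eq_bigl do rewrite inE.
rewrite -(pair_big_dep xpredT (fun x y => x ** y) (fun _ _ => 1%N)) /=.
by apply: eq_bigr => x _; rewrite -sum1_card; apply: eq_bigl => y; rewrite inE.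
Qed.

(** Noncentral centralizers have index at least [p], which bounds the number [T] of commuting pairs
    in terms of [#|Z|]. Comparison with the prescribed value leaves the claim multiplied by
    [(p - 1) * #|R|]. *)
Lemma commuting_probability_center (p : nat) :
    (1 < p)%N -> (forall d, (1 < d)%N -> (d %| #|R|)%N -> (p <= d)%N) ->
    commuting_probability R = (p%:R ^+ 2 + p%:R - 1) / p%:R ^+ 3 ->
  (#|R| <= p ^ 2 * #|Z|)%N.
Proof.
move=> p1 pmin; rewrite /commuting_probability card_commuting_pairs.
have R0 : (0 < #|R|)%N by apply/card_gt0P; exists 0.
have p0 : (0 < p)%N := ltnW p1.
move/eqP; rewrite eqr_div ?expf_neq0 ?pnatr_eq0 -?lt0n //.
set T := (\sum_x _)%N => /eqP E.
have {}E : (T * p ^ 3 + #|R| ^ 2 = (p ^ 2 + p) * #|R| ^ 2)%N.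
  apply/eqP; rewrite -(eqr_nat rat) !natrD !natrM !natrD !natrX E.
  by apply/eqP; ring.
have TZ : (T * p <= #|Z| * #|R| * p + (#|R| - #|Z|) * #|R|)%N.
  rewrite /T (bigID (mem Z)) /= mulnDl leq_add //.
    rewrite leq_mul2r -sum_nat_const leq_sum ?orbT // => x _.
    exact: max_card.
  have -> : (#|R| - #|Z|)%N = #|[pred x | x \notin Z]|.
    by rewrite -(cardC Z) addKn.
  rewrite big_distrl -sum_nat_const leq_sum // => x /rng_centerPn[y xy].
  rewrite -[X in (_ <= X)%N]cardsT -(Lagrange (subsetT (C x))).
  rewrite leq_mul2l pmin ?orbT //.
    rewrite indexg_gt1; apply/subsetPn; exists y; rewrite ?inE //.
  by rewrite -cardsT dvdn_indexg.
have ZR : (#|Z| <= #|R|)%N by apply: max_card.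
have {TZ} :
    (T * p * p ^ 2 <= (#|Z| * #|R| * p + (#|R| - #|Z|) * #|R|) * p ^ 2)%N.
  by rewrite leq_mul2r TZ orbT.
(* Writing [#|R|] as [#|Z| + s] and [p] as [q.+2] removes the truncated subtractions. *)
have [s rE] : exists s, #|R| = (#|Z| + s)%N.
  by exists (#|R| - #|Z|)%N; rewrite subnKC.
have [q pE] : exists q, p = q.+2.
  by exists p.-2; case: p p1 {pmin p0 E} => [|[]].
have -> : (#|R| - #|Z| = s)%N by rewrite rE addKn.
suff main : (T * p * p ^ 2 <= (#|Z| * #|R| * p + s * #|R|) * p ^ 2 ->
    q.+1 * #|R| * #|R| <= q.+1 * #|R| * (p ^ 2 * #|Z|))%N.
  by move/main; rewrite leq_pmul2l // muln_gt0 R0.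
move: E rE; move: #|R| #|Z| => r z; rewrite {}pE => E rE; subst r.
lia.
Qed.

Lemma unital_center_gt1 :
  rng_noncommutative R -> rng_has_unity R -> (1 < #|Z|)%N.
Proof.
move=> [x [y xy]] [e he]; rewrite (cardsD1 0).
have -> : 0 \in Z by apply/rng_centerP => t; rewrite rng_comm_sym rng_comm0.
rewrite ltnS card_gt0; apply/set0Pn; exists e; rewrite !inE; apply/andP; split.
  apply/eqP => e0; apply: xy; have [ex _] := he x; have [ey _] := he y.
  by rewrite -ex -ey e0 !rng_mul0r.
by apply/forallP => t; rewrite /rng_comm; have [-> ->] := he t.
Qed.

End Ring.

Theorem corollary2p6 (R : finRng) (ncR : rng_noncommutative R)
  (hR :
       n_centralizer_ring 4 R
    \/ n_centralizer_ring 5 R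
    \/ n_centralizer_ring 7 R
    \/ (exists p k : nat,
          [/\ prime p, n_centralizer_ring (p + 2) R & #|R| = (p ^ k)%N])
    \/ commuting_probability R = 5%:R / 8%:R
    \/ (let p := pdiv #|R| in
        commuting_probability R = (p%:R ^+ 2 + p%:R - 1) / p%:R ^+ 3)
    \/ (exists p : nat, prime p /\ #|R| = (p ^ 2)%N)
    \/ (exists p : nat, [/\ rng_has_unity R, prime p & #|R| = (p ^ 3)%N])) :
  msn_integral (commuting_graph R) /\ ~ msn_hyperenergetic (commuting_graph R).
Proof.
suff tr : comm_transitive R.
  have cl := cluster_commuting_graph tr.
  split; first exact: cluster_msn_integral.
  exact: cluster_not_msn_hyperenergetic (card_commuting_graph ncR).
have Z0 : (0 < #|rng_center R|)%N by apply: cardG_gt0.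
have R1 : (1 < #|R|)%N.
  by rewrite (leq_trans (ltnW (card_commuting_graph ncR))) // card_sig max_card.
have minR := @pdiv_min_dvd #|R|.
have prob p : (1 < p)%N -> (forall d, (1 < d)%N -> (d %| #|R|)%N -> (p <= d)%N) ->
    commuting_probability R = (p%:R ^+ 2 + p%:R - 1) / p%:R ^+ 3 ->
    comm_transitive R.
  move=> p1 pmin /(commuting_probability_center p1 pmin) hZ.
  apply: (comm_transitive_center_index pmin); apply: (leq_ltn_trans hZ).
  by rewrite ltn_pmul2r // ltn_exp2l.
have pow p k : prime p -> #|R| = (p ^ k.+1)%N ->
    (p ^ k.+1 < p ^ 3 * #|rng_center R|)%N -> comm_transitive R.
  move=> pp cR lt; apply: (@comm_transitive_center_index _ p); last by rewrite cR.
  by move=> d; have := minR d; rewrite cR pdiv_pfactor.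
case: hR => [h|[h|[h|[[p [k [pp h cR]]]|[h|[h|[[p [pp cR]]|[p [u pp cR]]]]]]]]].
- by apply: comm_transitive_card_centralizers; rewrite h.
- by apply: comm_transitive_card_centralizers; rewrite h.
- by apply: comm_transitive_card_centralizers; rewrite h.
- exact: comm_transitive_prime_power pp h cR.
(* 5/8 is the value of (p^2 + p - 1)/p^3 at p = 2, and 2 bounds every nontrivial divisor from
   below. *)
- by apply: (prob 2%N) => //; rewrite h; apply/eqP; vm_compute.
- by apply: (prob _ _ minR h); rewrite prime_gt1 // pdiv_prime.
- apply: (pow p 1%N) => //; apply: (@leq_trans (p ^ 3)).
    by rewrite ltn_exp2l ?prime_gt1.
  by rewrite leq_pmulr.
(* Here the strict inequality needs a nonzero central element, the unity. *)
- apply: (pow p 2%N) => //.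
  by rewrite ltn_Pmulr ?unital_center_gt1 // expn_gt0 prime_gt0.
Qed.
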